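(* Let $\mathcal{A}$ be a universal, refinable axiomatic semantics that satisfies extensibility, over a given finite set of cores $\mathsf{Cores}$ and stages $\mathsf{Stages}$, and let $t\ge1$. Then synthesis of a finite-state, bounded-history operational model that is sound and $t$-complete with respect to $\mathcal{A}$ is feasible: one can construct an operational model $\mathcal{M}=(\mathcal{Q},\Delta,q_{\mathsf{init}},q_{\mathsf{final}})$ with $\mathcal{Q}$ finite and history parameter $h\in\mathbb{N}$ that is sound and $t$-complete w.r.t. $\mathcal{A}$.
   Context: Programming model: cores $\mathsf{Cores}=[n]$; finite operation set $\mathbb{O}$; a program $\mathcal{P}$ is a family of instruction streams $\mathcal{I}_c\in\mathbb{O}^*$; instructions $(c,j,\mathcal{I}_c[j])$ have core $c$, label $j$; events $i.\mathsf{st}$; $\mathsf{Events}(\mathcal{P})$ the events of $\mathcal{P}$. $\mu$spec axioms are first-order sentences quantifying over instructions (distinct variables get distinct instructions), built from atoms $i_1<_r i_2$ (same core, smaller label), predicates $\mathsf{P}(i_1,\ldots)$ (interpreted by fixed relations on operations), and $\mathsf{hb}(i_1.\mathsf{st}_1,i_2.\mathsf{st}_2)$. A $\mu$hb graph for $\mathcal{P}$ is a DAG $G=(V,E)$ with $V=\mathsf{Events}(\mathcal{P})$, where $\mathsf{hb}$ is interpreted by $E^+$; $G\models_{\mathcal{P}}\mathcal{A}$ means all axioms hold. Universal: every axiom has the form $\forall i_1\cdots\forall i_k\,\phi$ with $\phi$ quantifier-free. Refinable: for every $\mathcal{P}$ and $G\models_{\mathcal{P}}\mathcal{A}$, every linear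 graph $G'$ on the same vertices with $E^+\subseteq E'^+$ satisfies $G'\models_{\mathcal{P}}\mathcal{A}$. Extensible: for all $\mathcal{P}'\preceq\mathcal{P}$ (each stream of $\mathcal{P}'$ a prefix of that of $\mathcal{P}$) with residual $\mathcal{P}''$ (the remaining suffixes), if $G'\models_{\mathcal{P}'}\textsc{ax}$ and $G''\models_{\mathcal{P}''}\textsc{ax}$ then $G'\triangleright G''\models_{\mathcal{P}}\textsc{ax}$ for every axiom, where $G'\triangleright G''$ is the disjoint union plus edges from every sink of $G'$ to every source of $G''$. Operational model: $(\mathcal{Q},\Delta,q_{\mathsf{init}},q_{\mathsf{final}})$ with history parameter $h$, reading each core's stream from a read-only one-way tape; transitions depend on the state and the symbols under the heads and either move a head right, do nothing, emit an event $i.\mathsf{st}$ for an instruction $i$ among those left of a head, or drop such an instruction; configurations with more than $h$ instructions left of some head are disallowed. $\mathsf{Traces}(\mathcal{M},\mathcal{P})$: sequences of emitted events of accepting runs (ending in the absorbing state $q_{\mathsf{final}}$), viewed as linear $\mu$hb graphs. Sound: for every $\mathcal{P}$, each trace in $\mathsf{Traces}(\mathcal{M},\mathcal{P})$ is a linearization of some $G\models_{\mathcal{P}}\mathcal{A}$. $t$-reordering bounded trace $\sigma$ (listing each event of $\mathcal{P}$ once): with $\mathsf{diff}_r(i_1,i_2)=\mathsf{label}(i_2)-\mathsf{label}(i_1)$, $\mathsf{start}/\mathsf{end}(i)$ the first/last index of an event of $i$, $\mathsf{pfxend}(i)=\max\{\mathsf{end}(i'):i'\le_r i\}$, and $\mathsf{coup}(i_1,i_2)$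 meaning $[\mathsf{start}(i_1),\mathsf{pfxend}(i_1)]$ and $[\mathsf{start}(i_2),\mathsf{pfxend}(i_2)]$ overlap: for all same-core $i_1,i_2$, (1) if an event of $i_2$ precedes an event of $i_1$ then $\mathsf{diff}_r(i_1,i_2)<t$, and (2) if $\mathsf{coup}(i_1,i),\mathsf{coup}(i,i_2)$ for some $i$ then $|\mathsf{diff}_r(i_1,i_2)|<t$. $t$-complete: for every $\mathcal{P}$ and $G\models_{\mathcal{P}}\mathcal{A}$, $\mathsf{Traces}(\mathcal{M},\mathcal{P})$ contains all $t$-reordering bounded linearizations of $G$. *)

(* Defs.v *)
From HB Require Import structures.
From mathcomp Require Import all_boot all_order all_algebra.
From Stdlib Require List Relation_Operators.

Set Implicit Arguments.
Unset Strict Implicit.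
Unset Printing Implicit Defensive.

Import Order.TTheory GRing.Theory Num.Theory.

Section Programs.

Variables (n : nat) (Op Stage : finType).

Definition program := 'I_n -> seq Op.

(* The triple (c, j, I_c[j]); labels are counted from 0. *)
Definition instr := ('I_n * nat * Op)%type.
Definition core (i : instr) : 'I_n := i.1.1.
Definition label (i : instr) : nat := i.1.2.
Definition opn (i : instr) : Op := i.2.

Definition event := (instr * Stage)%type.

Definition instrs (P : program) : seq instr :=
  [seq (c, p.1, p.2) | c <- enum 'I_n, p <- zip (iota 0 (size (P c))) (P c)].

Definition Events (P : program) : seq event :=
  [seq (i, s) | i <- instrs P, s <- enum Stage].

Definition prog_lt (i1 i2 : instr) : bool :=
  (core i1 == core i2) && (label i1 < label i2).
Definition prog_le (i1 i2 : instr) : bool := (i1 == i2) || prog_lt i1 i2.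

Definition prefix_program (P' P : program) : Prop :=
  forall c, prefix (P' c) (P c).

(* As a program in its own right, so its labels start again from 0. *)
Definition residual (P' P : program) : program :=
  fun c => drop (size (P' c)) (P c).

Definition graph := rel event.

Definition hb (G : graph) : event -> event -> Prop :=
  Relation_Operators.clos_trans event (fun e1 e2 => G e1 e2).

(* G is the edge relation of a DAG with vertex set Events P. *)
Definition uhb_graph (P : program) (G : graph) : Prop :=
  (forall e1 e2, G e1 e2 -> e1 \in Events P /\ e2 \in Events P) /\
  (forall e, ~ hb G e e).

Definition linear_graph (P : program) (G : graph) : Prop :=
  uhb_graph P G /\
  {in Events P &, forall e1 e2, e1 <> e2 -> hb G e1 e2 \/ hb G e2 e1}.

Definition sink (P : program) (G : graph) (e : event) : bool :=
  (e \in Events P) && all (fun e' => ~~ G e e') (Events P).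
Definition source (P : program) (G : graph) (e : event) : bool :=
  (e \in Events P) && all (fun e' => ~~ G e' e) (Events P).

(* An event of the residual of P' with label j is the event with label
   j + size (P' c) of the whole program; [late] recognizes the labels of this
   form and [unshift] recovers the event of the residual. *)
Definition late (P' : program) (e : event) : bool :=
  size (P' (core e.1)) <= label e.1.
Definition unshift (P' : program) (e : event) : event :=
  ((core e.1, label e.1 - size (P' (core e.1)), opn e.1), e.2).

(* G' |> G'', for uhb graphs G' of P' and G'' of P'' = residual P' P. *)
Definition seq_comp (P' P'' : program) (G' G'' : graph) : graph :=
  fun e1 e2 =>
    [|| G' e1 e2,
        [&& late P' e1, late P' e2 & G'' (unshift P' e1) (unshift P' e2)]
      | [&& sink P' G' e1, late P' e2 & source P'' G'' (unshift P' e2)]].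

Definition linearization (P : program) (G : graph) (s : seq event) : Prop :=
  [/\ uniq s, s =i Events P
    & forall e1 e2, hb G e1 e2 -> index e1 s < index e2 s].

End Programs.

Record signature (Op : finType) := Signature {
  psym : Type;
  arity : psym -> nat;
  interp : forall p : psym, (arity p).-tuple Op -> bool
}.

Section Formulas.

Variables (Op Stage : finType) (S : signature Op).

(* [formula k] has its free variables among the de Bruijn indices 'I_k; the
   variable bound by a quantifier is index 0 of its body. *)
Inductive formula : nat -> Type :=
| FBefore k of 'I_k & 'I_k : formula k
| FPred k (p : psym S) of (arity p).-tuple 'I_k : formula k
| FHb k of 'I_k & Stage & 'I_k & Stage : formula k
| FNot k of formula k : formula k
| FAnd k of formula k & formula k : formula k
| FOr k of formula k & formula k : formula k
| FForall k of formula k.+1 : formula k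
| FExists k of formula k.+1 : formula k.

Definition sentence := formula 0.
Definition semantics := seq sentence.

Fixpoint quantifier_free k (f : formula k) : bool :=
  match f with
  | FBefore _ _ _ | FPred _ _ _ | FHb _ _ _ _ _ => true
  | FNot _ f => quantifier_free f
  | FAnd _ f g | FOr _ f g => quantifier_free f && quantifier_free g
  | FForall _ _ | FExists _ _ => false
  end.

Fixpoint universal_formula k (f : formula k) : bool :=
  match f with
  | FForall _ f => universal_formula f
  | f => quantifier_free f
  end.

Definition universal (A : semantics) : Prop :=
  forall ax, List.In ax A -> universal_formula ax.

Variable n : nat.
Implicit Types (P : program n Op) (G : graph n Op Stage).

(* A quantifier ranges over the instructions of P other than those already
   assigned to the variables in scope. *)
Fixpoint holds P G k (f : formula k) : k.-tuple (instr n Op) -> Prop :=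
  match f in formula k return k.-tuple (instr n Op) -> Prop with
  | FBefore _ x y => fun v => prog_lt (tnth v x) (tnth v y)
  | FPred _ p xs => fun v => interp [tuple of map (fun x => opn (tnth v x)) xs]
  | FHb _ x s y s' => fun v => hb G (tnth v x, s) (tnth v y, s')
  | FNot _ f => fun v => ~ holds P G f v
  | FAnd _ f g => fun v => holds P G f v /\ holds P G g v
  | FOr _ f g => fun v => holds P G f v \/ holds P G g v
  | FForall _ f => fun v =>
      forall i, i \in instrs P -> i \notin v -> holds P G f [tuple of i :: v]
  | FExists _ f => fun v =>
      exists i, [/\ i \in instrs P, i \notin v & holds P G f [tuple of i :: v]]
  end.

Definition models_axiom P G (ax : sentence) : Prop := holds P G ax [tuple].

Definition models P G (A : semantics) : Prop :=
  forall ax, List.In ax A -> models_axiom P G ax.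

End Formulas.

Section Properties.

Variables (n : nat) (Op Stage : finType) (S : signature Op).
Implicit Types (A : semantics Stage S) (P : program n Op)
  (G : graph n Op Stage).

Definition refinable A : Prop :=
  forall P G, uhb_graph P G -> models P G A ->
  forall G', linear_graph P G' ->
    (forall e1 e2, hb G e1 e2 -> hb G' e1 e2) -> models P G' A.

Definition extensible A : Prop :=
  forall P' P, prefix_program P' P ->
  forall G' G'', uhb_graph P' G' -> uhb_graph (residual P' P) G'' ->
  forall ax, List.In ax A ->
    models_axiom P' G' ax -> models_axiom (residual P' P) G'' ax ->
    models_axiom P (seq_comp P' (residual P' P) G' G'') ax.

End Properties.

Section OperationalModels.

Variables (n : nat) (Op Stage : finType).

(* [None] is the end-of-stream symbol. *)
Definition symbols := {ffun 'I_n -> option Op}.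

(* Instructions left of a head are addressed by their position, oldest first,
   among those that have not been dropped. *)
Inductive action (h : nat) :=
| Right of 'I_n
| Stay
| Emit of 'I_n & 'I_h & Stage
| Drop of 'I_n & 'I_h.

Record opmodel := OpModel {
  state : finType;
  history : nat;
  delta : state -> symbols -> action history -> state -> bool;
  q_init : state;
  q_final : state;
  q_final_absorbing :
    forall a act q, delta q_final a act q -> q = q_final
}.

(* [hist c] lists the instructions left of the head of core c that have not
   been dropped; [hpos c] is the label of the instruction under that head. *)
Record config (M : opmodel) := Config {
  cstate : state M;
  hpos : {ffun 'I_n -> nat};
  hist : {ffun 'I_n -> seq (instr n Op)}
}.

Definition read (P : program n Op) (hd : {ffun 'I_n -> nat}) : symbols :=
  [ffun c => onth (P c) (hd c)].

Definition update (T : Type) (f : {ffun 'I_n -> T}) (c : 'I_n) (x : T) :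
  {ffun 'I_n -> T} := [ffun d => if d == c then x else f d].

Definition allowed M (C : config M) : Prop :=
  forall c, size (hist C c) <= history M.

Inductive step (M : opmodel) (P : program n Op) :
  config M -> option (event n Op Stage) -> config M -> Prop :=
| StepRight (q : state M) hd (l : {ffun 'I_n -> seq (instr n Op)}) c o q' of
    delta q (read P hd) (Right _ c) q' & onth (P c) (hd c) = Some o :
    step P (Config q hd l) None
      (Config q' (update hd c (hd c).+1)
         (update l c (rcons (l c) (c, hd c, o))))
| StepStay (q : state M) hd (l : {ffun 'I_n -> seq (instr n Op)}) q' of
    delta q (read P hd) (Stay _) q' :
    step P (Config q hd l) None (Config q' hd l)
| StepEmit (q : state M) hd (l : {ffun 'I_n -> seq (instr n Op)}) c k s i q' of
    delta q (read P hd) (Emit c k s) q' & onth (l c) k = Some i :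
    step P (Config q hd l) (Some (i, s)) (Config q' hd l)
| StepDrop (q : state M) hd (l : {ffun 'I_n -> seq (instr n Op)}) c k q' of
    delta q (read P hd) (Drop c k) q' & k < size (l c) :
    step P (Config q hd l) None
      (Config q' hd (update l c (take k (l c) ++ drop k.+1 (l c)))).

Inductive run (M : opmodel) (P : program n Op) :
  config M -> seq (event n Op Stage) -> config M -> Prop :=
| RunNil C : run P C [::] C
| RunCons C e C' s C'' of
    step P C e C' & allowed C' & run P C' s C'' :
    run P C (if e is Some x then x :: s else s) C''.

Definition init_config M : config M :=
  Config (q_init M) [ffun=> 0] [ffun=> [::]].

Definition Traces M (P : program n Op) (s : seq (event n Op Stage)) : Prop :=
  exists C, run P (init_config M) s C /\ cstate C = q_final M.

End OperationalModels.

Section Reordering.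

Variables (n : nat) (Op Stage : finType).
Implicit Types (P : program n Op) (s : seq (event n Op Stage))
  (i : instr n Op).

Definition diff i1 i2 : int := ((label i2)%:Z - (label i1)%:Z)%R.

(* Meant for traces s that list each event of P exactly once. *)
Definition start s i : nat := find (fun e => e.1 == i) s.
Definition finish s i : nat := \max_(st : Stage) index (i, st) s.
Definition pfxend P s i : nat :=
  \max_(i' <- instrs P | prog_le i' i) finish s i'.

Definition coup P s i1 i2 : Prop :=
  exists k, (start s i1 <= k <= pfxend P s i1) &&
            (start s i2 <= k <= pfxend P s i2).

Definition reordering_bounded (t : nat) P s : Prop :=
  {in instrs P &, forall i1 i2, core i1 = core i2 ->
    ((exists st1 st2, index (i2, st2) s < index (i1, st1) s) ->
       (diff i1 i2 < t%:Z)%R) /\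
    ((exists i, [/\ i \in instrs P, coup P s i1 i & coup P s i i2]) ->
       (`|diff i1 i2| < t%:Z)%R)}.

End Reordering.

Section Correctness.

Variables (n : nat) (Op Stage : finType) (S : signature Op).
Implicit Types (M : opmodel n Op Stage) (A : semantics Stage S).

Definition sound M A : Prop :=
  forall P s, Traces M P s ->
  exists G, [/\ uhb_graph P G, models P G A & linearization P G s].

Definition complete (t : nat) M A : Prop :=
  forall P G, uhb_graph P G -> models P G A ->
  forall s, linearization P G s -> reordering_bounded t P s -> Traces M P s.

End Correctness.

(* Main.v *)
(* Refinability reduces both directions to traces viewed as linear graphs, so
   the model only has to check that its own trace satisfies the axioms.
   With K bounding the number of variables of an axiom, it maintains the set
   of types of all partial assignments of K variables to instructions already
   read: operations, program order, emitted events and emission order, plus the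
   history position of instructions not dropped yet.  This finite set is updated
   exactly by every action, and the matrix of a universal axiom depends only on
   the type of the assignment.  For completeness, heads advance only up to the
   instruction whose event is emitted next, and an instruction is dropped as
   soon as all its events have been emitted; an undropped instruction thus has
   an event still to come, and clause (1) of reordering boundedness puts its
   label within t of the instruction being emitted, so that histories have
   length at most t. *)

Require Import Defs.
From mathcomp Require Import all_boot all_order all_algebra.

Set Implicit Arguments.
Unset Strict Implicit.
Unset Printing Implicit Defensive.

Import GRing.Theory Num.Theory.

Lemma index_onth (T : eqType) (l : seq T) k x :
  uniq l -> onth l k = Some x -> index x l = k.
Proof.
move=> ul lk; have kl : k < size l by rewrite -onthTE lk.
by rewrite -(onth_nth x _ _ _ lk) index_uniq.
Qed.

(** * Traces viewed as linear graphs *)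

Section TraceGraph.

Variables (n : nat) (Op Stage : finType).
Implicit Types (P : program n Op) (s : seq (event n Op Stage))
  (i : instr n Op).

Lemma mem_instrs P i :
  (i \in instrs P) = (onth (P (core i)) (label i) == Some (opn i)).
Proof.
case: i => [[c j] o]; rewrite /core /label /opn /=.
(* The start [m] of [iota] is generalized, since the induction shifts it by one at each entry. *)
have zipE (l : seq Op) m (p : nat * Op) :
    (p \in zip (iota m (size l)) l) =
    (m <= p.1) && (onth l (p.1 - m) == Some p.2).
  elim: l m p => [|a l IH] m p /=; first by rewrite onth0n andbF.
  rewrite inE IH; case: p => p o' /=; rewrite -pair_eqE /=.
  case: (ltngtP p m) => [lt|lt|->] /=.
  - by [].
  - by rewrite subnS; case: (p - m) (ltn0Sn (p - m.+1)) (subnSK lt) => // k _ [<-].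
  - by rewrite subnn orbF eq_sym.
apply/allpairsPdep/eqP => [[c' [p [_]]]|E].
  by rewrite zipE subn0 /= => /eqP pE [-> -> ->].
exists c, (j, o); split=> //; first by rewrite mem_enum.
by rewrite zipE subn0 /= E.
Qed.

Lemma mem_Events P (e : event n Op Stage) :
  (e \in Events Stage P) = (e.1 \in instrs P).
Proof.
case: e => i st /=; apply/allpairsP/idP => [[p [ip _ [-> _]]] //|iP].
by exists (i, st); rewrite mem_enum.
Qed.

Definition emitted_before s (e1 e2 : event n Op Stage) : bool :=
  [&& e1 \in s, e2 \in s & index e1 s < index e2 s].

(** Comparison of positions in [s] is already transitive, so the closure adds no pair. *)
Lemma hb_emitted_before s e1 e2 :
  hb (emitted_before s) e1 e2 <-> emitted_before s e1 e2.
Proof.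
split=> [|h]; last exact: Relation_Operators.t_step.
elim=> {e1 e2} [e1 e2 h|x y z _ /and3P[xs _ xy] _ /and3P[_ zs yz]].
  exact: h.
by rewrite /emitted_before xs zs (ltn_trans xy yz).
Qed.

Lemma emitted_before_linear P s :
  s =i Events Stage P -> linear_graph P (emitted_before s).
Proof.
move=> sP; split; first split.
- by move=> e1 e2 /and3P[]; rewrite !sP.
- by move=> e /hb_emitted_before/and3P[_ _]; rewrite ltnn.
move=> e1 e2; rewrite -!sP => h1 h2 ne.
rewrite !hb_emitted_before /emitted_before h1 h2 /=.
case: (ltngtP (index e1 s) (index e2 s)) => [||E]; [by left | by right |].
by case: ne; rewrite -(nth_index e1 h1) E nth_index.
Qed.

(** Appending leaves earlier indices unchanged, so the new pairs are determined by which events were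
    emitted before; this is what lets a type track the emission order. *)
Lemma emitted_before_rcons s e e1 e2 : e \notin s ->
  emitted_before (rcons s e) e1 e2 =
  emitted_before s e1 e2 || (e1 \in s) && (e2 == e).
Proof.
move=> es; rewrite /emitted_before !mem_rcons !inE -cats1 !index_cat /=.
have ix x : x \in s -> index x s < size s by rewrite -index_mem.
case: (eqVneq e1 e) => [->|ne1] /=.
  rewrite (negPf es) addn0 /= (eq_sym e2); case: (boolP (e2 \in s)) => [e2s|_].
    by rewrite ltnNge ltnW ?ix // andbF.
  by case: eqP => //=; rewrite addn0 ltnn.
case: (eqVneq e2 e) => [->|ne2] /=.
  rewrite (negPf es) addn0 andbF andbT.
  by case: ifP => // e1s; rewrite ix.
by rewrite andbF orbF; case: (e1 \in s) => //=; case: (e2 \in s).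
Qed.

End TraceGraph.

(** * Types of partial valuations and their updates *)

Section Valuations.

Variables (n : nat) (Op Stage : finType) (h K : nat).

Notation instr := (instr n Op).
Notation event := (event n Op Stage).
Notation hists := {ffun 'I_n -> seq instr}.

(** The successor keeps the set of variables inhabited even when [K] is 0: valuations of a single
    instruction are placed at [ord0]. *)
Definition variable := 'I_K.+1.

(* What the model knows of a partial valuation: the core and operation of the
   instruction assigned to each variable, with its position in the history
   unless it has been dropped; the program order among these instructions;
   which of their events have been emitted; and the order of emission. *)
Definition vtype : finType :=
  ({ffun variable -> option ('I_n * Op * option 'I_h.+1)} *
   {ffun variable * variable -> bool} *
   {ffun variable * Stage -> bool} *
   {ffun (variable * Stage) * (variable * Stage) -> bool})%type.

Definition info (u : vtype) := u.1.1.1.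
Definition before (u : vtype) := u.1.1.2.
Definition emitted (u : vtype) := u.1.2.
Definition ordered (u : vtype) := u.2.

Lemma vtypeP (u v : vtype) :
  info u =1 info v -> before u =1 before v ->
  emitted u =1 emitted v -> ordered u =1 ordered v -> u = v.
Proof.
case: u => [[[a b] c] d]; case: v => [[[a' b'] c'] d'].
by rewrite /info /before /emitted /ordered /= => /ffunP-> /ffunP-> /ffunP-> /ffunP->.
Qed.

(** For an instruction already read, [None] means dropped. The default of [inord] never shows under
    [proper_hist], which keeps indices at most [h]. *)
Definition slot (l : seq instr) (i : instr) : option 'I_h.+1 :=
  if i \in l then Some (inord (index i l)) else None.

Definition valuation := variable -> option instr.
Implicit Types (k : 'I_h.+1) (w : valuation) (l : hists) (s : seq event) (u : vtype).

Definition valid (R : pred instr) w : Prop :=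
  (forall x i, w x = Some i -> R i) /\
  (forall x y i, w x = Some i -> w y = Some i -> x = y).

Definition type_of l s w : vtype :=
  ([ffun x => omap (fun i => (core i, opn i, slot (l (core i)) i)) (w x)],
   [ffun p => if (w p.1, w p.2) is (Some i, Some j) then prog_lt i j
              else false],
   [ffun p => if w p.1 is Some i then (i, p.2) \in s else false],
   [ffun p => if (w p.1.1, w p.2.1) is (Some i, Some j)
              then emitted_before s (i, p.1.2) (j, p.2.2) else false]).

Definition at_slot u c (k : 'I_h.+1) (x : variable) : bool :=
  if info u x is Some (c', _, Some k') then (c' == c) && (k' == k) else false.

(** [ordered] consults the old [emitted], so that the new event is placed after all earlier ones and
    not after itself. *)
Definition type_emit c k st u : vtype :=
  (info u, before u,
   [ffun p => emitted u p || at_slot u c k p.1 && (p.2 == st)],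
   [ffun p => ordered u p ||
      [&& emitted u p.1, at_slot u c k p.2.1 & p.2.2 == st]]).

Definition slot_drop (k k' : 'I_h.+1) : option 'I_h.+1 :=
  if k' == k then None else Some (inord (if k < k' then k'.-1 else k')).

Definition type_drop c k u : vtype :=
  ([ffun x => if info u x is Some (c', o, Some k') then
                Some (c', o, if c' == c then slot_drop k k' else Some k')
              else info u x],
   before u, emitted u, ordered u).

(** The instruction just read is the last of its core and has no emitted event: it follows every
    assigned instruction of that core, and the emission data do not change. *)
Definition type_assign c o k x u : vtype :=
  ([ffun y => if y == x then Some (c, o, Some k) else info u y],
   [ffun p => before u p || (p.2 == x) &&
      (if info u p.1 is Some (c', _, _) then c' == c else false)],
   emitted u, ordered u).

Definition upd w x (a : option instr) : valuation :=
  fun y => if y == x then a else w y.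

Definition proper_hist (R : pred instr) (l : hists) : Prop :=
  forall c, [/\ uniq (l c), size (l c) <= h.+1
    & {in l c, forall i, core i = c /\ R i}].

Lemma slotP (l : seq instr) i k : uniq l -> size l <= h.+1 ->
  (slot l i == Some k) = (onth l k == Some i).
Proof.
move=> ul sl; rewrite /slot; case: ifP => il; apply/eqP/eqP.
- move=> [<-]; rewrite inordK; last first.
    by apply: leq_trans sl; rewrite index_mem.
  by rewrite onthE (nth_map i) ?index_mem // nth_index.
- by move=> /(index_onth ul) ->; rewrite inord_val.
- by [].
- by move=> E; move: il; rewrite (introT onthP) //; exists k.
Qed.

(** Histories have no repetitions, so a position in one identifies an instruction; hence actions
    that address positions can be simulated on types. *)
Lemma at_slotP (R : pred instr) l s w c k x i : proper_hist R l ->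
  onth (l c) k = Some i ->
  at_slot (type_of l s w) c k x = (w x == Some i).
Proof.
move=> pl lk; have [ul sl inl] := pl c.
have il : i \in l c by apply/onthP; exists k.
rewrite /at_slot /info ffunE; case: (w x) => //= j.
have [ic _] := inl _ il.
have -> : (Some j == Some i) = (core j == c) && (slot (l (core j)) j == Some k).
  case: (eqVneq (core j) c) => [->|ne] /=.
    by rewrite slotP // lk eq_sym.
  by apply/eqP => -[E]; rewrite E ic eqxx in ne.
by case: (slot _ j) => [k'|]; rewrite ?andbF //.
Qed.

Lemma type_emitP (R : pred instr) l s w c k st i : proper_hist R l ->
  onth (l c) k = Some i -> (i, st) \notin s ->
  type_of l (rcons s (i, st)) w = type_emit c k st (type_of l s w).
Proof.
move=> pl lk es; apply: vtypeP => // p; rewrite /emitted /ordered !ffunE /=.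
- rewrite (at_slotP _ _ _ pl lk); case: (w p.1) => // j.
  by rewrite mem_rcons inE orbC -pair_eqE.
- rewrite (at_slotP _ _ _ pl lk).
  case: (w p.1.1) => // j; case: (w p.2.1) => [j'|]; last by rewrite andbF.
  by rewrite emitted_before_rcons.
Qed.

Lemma slot_rem (l : seq instr) i k j : uniq l -> size l <= h.+1 ->
  onth l k = Some i ->
  slot (rem i l) j =
  if slot l j is Some k' then slot_drop k k' else None.
Proof.
move=> ul sl lk.
have il : i \in l by apply/onthP; exists k.
have kE := index_onth ul lk.
rewrite /slot mem_rem_uniq // inE.
case: (eqVneq j i) => [->|ne] /=; first by rewrite il /slot_drop kE inord_val eqxx.
case: ifP => // jl.
have jx : index j l < h.+1 by apply: leq_trans sl; rewrite index_mem.
have nek : index j l != k.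
  by apply: contra ne => /eqP jk; rewrite -(nth_index i jl) jk -kE nth_index.
rewrite /slot_drop -val_eqE /= inordK // (negPf nek); congr (Some (inord _)).
(* [rem i l] is [l] with position [k] cut out: entries before the cut keep their index, those after
   it lose one. *)
rewrite remE kE index_cat in_take //.
case: (ltngtP (index j l) k) => [lt|lt|E]; last by rewrite E eqxx in nek.
  rewrite -[in RHS](cat_take_drop k l) index_cat in_take // lt //.
have jd : j \in drop k.+1 l.
  move: (jl); rewrite -{1}(cat_take_drop k.+1 l) mem_cat in_take // ltnS leqNgt lt.
  by [].
have st : size (take k.+1 l) = k.+1.
  rewrite size_takel //; apply: leq_trans lt _; exact: index_size.
rewrite -[in RHS](cat_take_drop k.+1 l) index_cat in_take // ltnS leqNgt lt /= st.
by rewrite size_takel // -kE; apply: index_size.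
Qed.

Lemma type_dropP (R : pred instr) l s w c k i : proper_hist R l ->
  onth (l c) k = Some i ->
  type_of (update l c (take k (l c) ++ drop k.+1 (l c))) s w =
  type_drop c k (type_of l s w).
Proof.
move=> pl lk; have [ul sl inl] := pl c.
have kE := index_onth ul lk.
apply: vtypeP => // x; rewrite /info !ffunE; case: (w x) => //= j.
rewrite ffunE; case: eqVneq => [->|ne].
  rewrite -{1 2}kE -remE (slot_rem _ ul sl lk).
  by case: (slot (l c) j).
by case: (slot _ j).
Qed.

Lemma slot_rcons (l : seq instr) i j : i != j ->
  slot (rcons l i) j = slot l j.
Proof.
move=> ne; rewrite /slot mem_rcons inE eq_sym (negPf ne) /=.
by case: ifP => // jl; rewrite -cats1 index_cat jl.
Qed.

Lemma type_rconsP l s w c i : core i = c -> (forall x, w x <> Some i) ->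
  type_of (update l c (rcons (l c) i)) s w = type_of l s w.
Proof.
move=> ic wi; apply: vtypeP => // x; rewrite /info !ffunE.
case E: (w x) => [j|] //=; rewrite ffunE; case: eqVneq => [->|//].
by rewrite slot_rcons //; apply/eqP => ij; apply: (wi x); rewrite E ij.
Qed.

Lemma type_assignP (R : pred instr) l s w c i x : core i = c ->
  (forall j, R j -> core j = c -> label j < label i) ->
  (forall st, (i, st) \notin s) -> ~~ R i -> valid R w -> w x = None ->
  i \notin l c ->
  type_of (update l c (rcons (l c) i)) s (upd w x (Some i)) =
  type_assign c (opn i) (inord (size (l c))) x (type_of l s w).
Proof.
move=> ic lt ns nR [wR wI] wx il.
apply: vtypeP => p; rewrite /info /before /emitted /ordered !ffunE /= /upd.
- case: eqVneq => [_|ne] /=.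
    rewrite ic ffunE eqxx /slot mem_rcons inE eqxx /=.
    by rewrite -cats1 index_cat (negPf il) /= eqxx addn0.
  case E: (w p) => [j|] //=; rewrite ffunE; case: eqVneq => [->|//].
  rewrite slot_rcons //; apply: contra nR => /eqP ->; exact: wR E.
- case: p => y z /=; rewrite ?ffunE /=.
  case: (eqVneq y x) => [->|ney] /=.
    rewrite wx andbF; case: (eqVneq z x) => [_|nez] /=.
      by rewrite /prog_lt ltnn andbF.
    (* No instruction read earlier follows the new one in program order. *)
    case E: (w z) => [j|] //; apply/negP => /andP[/eqP ci].
    by apply/negP; rewrite -leqNgt ltnW // lt ?(wR _ _ E) // -ci.
  case E: (w y) => [j|] /=; last by rewrite andbF.
  case: (eqVneq z x) => [->|nez] /=; last by rewrite orbF.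
  rewrite wx /prog_lt ic; case: eqVneq => //= jc.
  by rewrite lt // (wR _ _ E).
- case: eqVneq => [->|ne] //; by rewrite wx (negPf (ns _)).
- case: p => [[y a] [z b]] /=.
  case: (eqVneq y x) => [->|ney] /=.
    rewrite wx; case: (if z == x then _ else _) => // j.
    by rewrite /emitted_before (negPf (ns _)).
  case: (w y) => // j; case: (eqVneq z x) => [->|//].
  by rewrite wx /emitted_before (negPf (ns b)) andbF.
Qed.

End Valuations.

(** * Evaluating universal axioms on types *)

Section Checking.

Variables (n : nat) (Op Stage : finType) (S : signature Op) (h K : nat).

Notation instr := (instr n Op).
Notation event := (event n Op Stage).
Notation vtype := (vtype n Op Stage h K).
Notation variable := (variable K).

(* The quantifiers of a universal sentence are ignored: its matrix is read with
   de Bruijn indices as variables. *)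
Fixpoint check k (f : formula Stage S k) (u : vtype) : bool :=
  match f with
  | FBefore _ x y => before u (inord x, inord y)
  | FPred _ p xs => [exists ops : (arity p).-tuple Op,
      (map Some ops == map (fun x : 'I__ =>
         omap (fun a => a.1.2) (info u (inord x))) xs) && interp ops]
  | FHb _ x s y s' => ordered u ((inord x, s), (inord y, s'))
  | FNot _ f => ~~ check f u
  | FAnd _ f g => check f u && check g u
  | FOr _ f g => check f u || check g u
  | FForall _ f => check f u
  | FExists _ f => check f u
  end.

Fixpoint qdepth k (f : formula Stage S k) : nat :=
  if f is FForall _ f then (qdepth f).+1 else 0.

Lemma qdepth_qf k (f : formula Stage S k) : quantifier_free f -> qdepth f = 0.
Proof. by case: f. Qed.

(** Each atom is read off from one component of the type. The histories [l] are arbitrary because no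
    atom looks at slots. *)
Lemma check_qf P (l : {ffun 'I_n -> seq instr}) (s : seq event)
    (w : valuation n Op K) k (f : formula Stage S k) (v : k.-tuple instr) :
  quantifier_free f -> (forall x : 'I_k, w (inord x) = Some (tnth v x)) ->
  holds P (emitted_before s) f v <-> check f (type_of h l s w).
Proof.
elim: f v => {k} [k x y|k p xs|k x a y b|k f IH|k f IHf g IHg|k f IHf g IHg|k f _|k f _]
  v //= qf wv.
- by rewrite /before ffunE /= !wv.
- have E : map (fun x : 'I_k => omap (fun a => a.1.2)
             (info (type_of h l s w) (inord x))) xs =
           map Some [tuple of map (fun x => opn (tnth v x)) xs].
    by rewrite /= -map_comp; apply: eq_map => x; rewrite /info ffunE wv.
  rewrite E; split=> [ip|/existsP[ops /andP[/eqP/inj_map-/(_ Some_inj) e ip]]].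
    by apply/existsP; exists [tuple of map (fun x => opn (tnth v x)) xs]; rewrite eqxx.
  by rewrite -(val_inj e).
- by rewrite hb_emitted_before /ordered ffunE /= !wv.
- by rewrite (IH v) //; split=> /negP.
- by case/andP: qf => qf qg; rewrite (IHf v) // (IHg v) //; split=> /andP.
- by case/andP: qf => qf qg; rewrite (IHf v) // (IHg v) //; split=> /orP.
Qed.

Lemma valid_onth P (u : seq instr) :
  uniq u -> {subset u <= instrs P} ->
  valid (mem (instrs P)) ((fun x => onth u x) : valuation n Op K).
Proof.
move=> uu sub; split=> [x i xi|x y i xi yi].
  by apply: sub; apply/onthP; exists x.
apply/val_inj/(onth_inj u) => //; last by rewrite xi yi.
by rewrite gtn_min -!onthTE xi orbT.
Qed.

(** [u] holds the values for the quantifiers still closed, and [w] extends [u ++ v]. As index 0 is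
    the innermost variable, opening a quantifier moves the last entry of [u] to the front of [v]. *)
Lemma check_universal P (l : {ffun 'I_n -> seq instr}) (s : seq event)
    k (f : formula Stage S k) (v : k.-tuple instr) :
  universal_formula f -> k + qdepth f <= K.+1 -> uniq v ->
  {subset v <= instrs P} ->
  holds P (emitted_before s) f v <->
  forall (u : seq instr) (w : valuation n Op K),
    size u = qdepth f -> {subset u <= instrs P} -> uniq (u ++ v) ->
    valid (mem (instrs P)) w ->
    (forall x : variable, x < size (u ++ v) -> w x = onth (u ++ v) x) ->
    check f (type_of h l s w).
Proof.
(* Every constructor other than [FForall] falls under the quantifier-free case, where [u] is
   empty. *)
have base k' (f' : formula Stage S k') (v' : k'.-tuple instr) :
    quantifier_free f' -> k' + qdepth f' <= K.+1 -> uniq v' ->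
    {subset v' <= instrs P} ->
    holds P (emitted_before s) f' v' <->
    forall (u : seq instr) (w : valuation n Op K),
      size u = qdepth f' -> {subset u <= instrs P} -> uniq (u ++ v') ->
      valid (mem (instrs P)) w ->
      (forall x : variable, x < size (u ++ v') -> w x = onth (u ++ v') x) ->
      check f' (type_of h l s w).
  move=> qf; rewrite (qdepth_qf qf) addn0 => kK uv vP.
  have iv (x : 'I_k') : (inord x : variable) = x :> nat.
    by rewrite inordK // (leq_trans (ltn_ord x)).
  have on (x : 'I_k') : onth v' x = Some (tnth v' x) by apply/tnth_onth.
  split=> [hf [] // w _ _ _ _ wE|H].
    apply: (iffLR (check_qf P l s qf _) hf) => x.
    by rewrite wE iv ?size_tuple //= on.
  (* The least valuation extending [v']: variables from [k'] on stay unassigned. *)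
  apply: (iffRL (check_qf (w := fun x => onth v' x) P l s qf _)).
    by move=> x; rewrite iv on.
  by apply: (H [::]) => //; apply: valid_onth.
elim: f v => {k}; try by move=> *; apply: base.
move=> k f IH v /= uf kK uv vP; split=> [hf u w|H i iP iv].
  case/lastP: u => [//|u i]; rewrite size_rcons cat_rcons => -[su] sub uu vw wE.
  move: (uu); rewrite cat_uniq => /and3P[_ _ /= /andP[iv _]].
  have iP : i \in instrs P by apply: sub; rewrite mem_rcons mem_head.
  apply: (iffLR (IH [tuple of i :: v] uf _ _ _) (hf i iP iv) u) => //=.
  - by rewrite addSnnS.
  - by rewrite iv.
  - by move=> j; rewrite inE => /predU1P[->//|]; apply: vP.
  - by move=> j ju; apply: sub; rewrite mem_rcons inE ju orbT.
apply/IH => //=; rewrite ?addSnnS ?iv //.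
  by move=> j; rewrite inE => /predU1P[->//|]; apply: vP.
move=> u w su sub uu vw wE.
apply: (H (rcons u i)); rewrite ?size_rcons ?su ?cat_rcons // => j.
by rewrite mem_rcons inE => /predU1P[->//|]; apply: sub.
Qed.

Variable A : semantics Stage S.
Hypothesis qdepth_le : forall ax, List.In ax A -> qdepth ax <= K.+1.

(** The guard skips valuations that leave a quantified variable of [ax] unassigned. As variables
    take distinct values, an axiom with more quantifiers than there are instructions is thus
    vacuous. *)
Definition good (u : vtype) : bool :=
  all (fun ax => [forall x : variable, (x < qdepth ax) ==> (info u x != None)]
                 ==> check ax u) A.

Lemma goodP u : reflect
  (forall ax, List.In ax A ->
     (forall x : variable, x < qdepth ax -> info u x != None) -> check ax u)
  (good u).
Proof.
rewrite /good; elim: A => [|ax B IH] /=; first by left.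
apply: (iffP andP) => [[h1 /IH h2] ax' [<-|]|H].
- by move=> ix; apply: (implyP h1); apply/forallP => x; apply/implyP; apply: ix.
- exact: h2.
split; last by apply/IH => ax' aB; apply: H; right.
apply/implyP => /forallP ix; apply: H; first by left.
by move=> x; apply/implyP.
Qed.

Lemma models_good P (l : {ffun 'I_n -> seq instr}) (s : seq event) :
  universal A ->
  models P (emitted_before s) A <->
  forall w, valid (K := K) (mem (instrs P)) w -> good (type_of h l s w).
Proof.
move=> uA.
have nP : {subset [tuple] <= instrs P} by [].
split=> [mA w vw|H ax aA].
  have [wP wI] := vw; apply/goodP => ax aA ix.
  have qK := qdepth_le aA.
  have wS j : j < qdepth ax -> w (inord j).
    move=> jq; have := ix (inord j).
    by rewrite inordK ?(leq_trans jq qK) // /info ffunE => /(_ jq); case: (w _).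
  have [u [su uw]] : exists u, size u = qdepth ax /\
      forall j, j < qdepth ax -> onth u j = w (inord j).
    (* All these values of [w] are defined, so [pmap] discards none and positions are preserved. *)
    pose r := iota 0 (qdepth ax); exists (pmap (fun j => w (inord j)) r).
    have E : map Some (pmap (fun j => w (inord j)) r) = map (fun j => w (inord j)) r.
      have : all (fun j => w (inord j)) r.
        by apply/allP => j; rewrite mem_iota => /wS.
      by elim: r => //= j r IH /andP[]; case: (w _) => //= a _ /IH ->.
    split=> [|j jq]; first by rewrite -(size_map Some) E size_map size_iota.
    by rewrite onthE E (nth_map 0) ?size_iota // nth_iota.
  have := mA ax aA; rewrite /models_axiom.
  move/(check_universal l s (v := [tuple]) (uA _ aA) qK isT nP)/(_ u w).
  rewrite cats0; apply=> //.
  - move=> i /onthP[j ju].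
    have jq : j < qdepth ax by rewrite -su -onthTE ju.
    by apply: (wP (inord j)); rewrite -uw.
  - case Eu: u => [//|i0 u0]; rewrite -Eu; apply/(uniqP i0) => a b.
    rewrite !inE su => aq bq.
    have nE j : j < qdepth ax -> w (inord j) = Some (nth i0 u j).
      by move=> jq; rewrite -uw // onthE (nth_map i0) ?su.
    move=> E; have := wI _ _ _ (nE _ aq); rewrite E => /(_ _ (nE _ bq)).
    by move/(congr1 val); rewrite /= !inordK ?(leq_trans _ qK).
  - by move=> x; rewrite su => xq; rewrite uw // inord_val.
apply/(check_universal l s (v := [tuple]) (uA _ aA) (qdepth_le aA) isT nP).
move=> u w su _ _ vw; rewrite cats0 su => wE.
apply: (elimT (goodP _) (H w vw)) => // x xq.
have : onth u x by rewrite onthTE su.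
by rewrite /info ffunE wE //; case: (onth u x).
Qed.

End Checking.

(** * The operational model and its invariant *)

Section Machine.

Variables (n : nat) (Op Stage : finType) (S : signature Op) (h K : nat).
Variable A : semantics Stage S.

Notation instr := (instr n Op).
Notation event := (event n Op Stage).
Notation vtype := (vtype n Op Stage h K).
Notation variable := (variable K).
Notation hists := {ffun 'I_n -> seq instr}.
Notation heads := {ffun 'I_n -> nat}.
Implicit Type k : 'I_h.+1.

(* A working state holds the types of all valuations by instructions left of
   the heads, and the lengths of the histories. *)
Definition working : finType := ({set vtype} * {ffun 'I_n -> 'I_h.+2})%type.

(** The guard of [Emit] forbids repeating an event, and that of [Drop] forbids losing one. [Stay] is
    reserved for the move to the final state. *)
Definition next (p : working) (a : symbols n Op) (act : action n Stage h.+1) :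
    option working :=
  match act with
  | Right c =>
      if a c is Some o then
        if p.2 c < h.+1 then
          Some (p.1 :|: \bigcup_x [set type_assign c o (inord (p.2 c)) x u
                                  | u in p.1 & info u x == None],
                update p.2 c (inord (p.2 c).+1))
        else None
      else None
  | Stay => None
  | Emit c k st =>
      if [forall u in p.1, forall x, at_slot u c k x ==> ~~ emitted u (x, st)]
      then Some (type_emit c k st @: p.1, p.2) else None
  | Drop c k =>
      if [forall u in p.1, forall x,
            at_slot u c k x ==> [forall st, emitted u (x, st)]]
      then Some (type_drop c k @: p.1, update p.2 c (inord (p.2 c).-1))
      else None
  end.

Definition accepting (p : working) (a : symbols n Op) : bool :=
  [forall c, a c == None] &&
  [forall u in p.1,
     good A u &&
     [forall x, if info u x is Some (_, _, Some _) then false else true]].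

Definition transition (q : option working) (a : symbols n Op)
    (act : action n Stage h.+1) (q' : option working) : bool :=
  match q, q' with
  | Some p, Some p' => next p a act == Some p'
  | Some p, None => (if act is Stay then true else false) && accepting p a
  | None, _ => false
  end.

Lemma transition_absorbing a act q : transition None a act q -> q = None.
Proof. by []. Qed.

Definition machine : opmodel n Op Stage :=
  OpModel (Some ([set type_of h [ffun=> [::]] [::] (fun=> None)], [ffun=> ord0]))
          transition_absorbing.

Definition left_of_head (P : program n Op) (hd : heads) : pred instr :=
  fun i => (label i < hd (core i)) && (i \in instrs P).

(** [inv_types] is an equivalence because soundness needs every valuation to be represented when
    axioms are checked, while completeness needs no spurious type to block an action. *)
Record invariant (P : program n Op) (hd : heads) (l : hists) (s : seq event)
    (p : working) : Prop := Invariant {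
  inv_hist : proper_hist h (left_of_head P hd) l;
  inv_uniq : uniq s;
  inv_read : forall e, e \in s -> left_of_head P hd e.1;
  inv_done : forall i st, left_of_head P hd i -> i \notin l (core i) -> (i, st) \in s;
  inv_size : forall c, p.2 c = size (l c) :> nat;
  inv_types : forall u, u \in p.1 <->
    exists2 w, valid (K := K) (left_of_head P hd) w & u = type_of h l s w
}.

Lemma type_of_ext l s (w w' : valuation n Op K) : w =1 w' ->
  type_of h l s w = type_of h l s w' :> vtype.
Proof.
move=> ww; apply: vtypeP => p.
- by rewrite /info !ffunE ww.
- by rewrite /before !ffunE !ww.
- by rewrite /emitted !ffunE ww.
- by rewrite /ordered !ffunE !ww.
Qed.

(** Supplies a type at which the guards of [Emit] and [Drop], and the acceptance test, really speak
    about [i]. *)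
Lemma invariant_single P hd l s p i : invariant P hd l s p ->
  left_of_head P hd i ->
  type_of h l s (upd (K := K) (fun=> None) ord0 (Some i)) \in p.1.
Proof.
move=> I iP; apply/(inv_types I); eexists; last reflexivity.
rewrite /upd; split=> [x j|x y j]; first by case: eqP => // _ [<-].
by case: eqP => // ->; case: eqP => // ->.
Qed.

Lemma invariant_emit P hd l s p a c k st i p' : invariant P hd l s p ->
  onth (l c) k = Some i -> next p a (Emit c k st) = Some p' ->
  invariant P hd l (rcons s (i, st)) p'.
Proof.
move=> I lk /=; case: ifP => // /forall_inP en [<-] {p'}.
have [_ _ inl] := inv_hist I c.
have [ic iP] : core i = c /\ left_of_head P hd i by apply/inl/onthP; exists k.
have es : (i, st) \notin s.
  have := forallP (en _ (invariant_single I iP)) ord0.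
  rewrite (at_slotP _ _ _ (inv_hist I) lk) /upd eqxx /=.
  by rewrite /emitted ffunE /= ?eqxx.
split=> //=; try by case: I.
- by rewrite rcons_uniq es (inv_uniq I).
- by move=> e; rewrite mem_rcons inE => /predU1P[->//|]; apply: inv_read I _.
- by move=> j st' jP jl; rewrite mem_rcons inE (inv_done I) ?orbT.
move=> u; split=> [/imsetP[v /(inv_types I)[w vw ->] ->]|[w vw ->]].
  by exists w => //; rewrite (type_emitP _ (inv_hist I) lk).
rewrite (type_emitP _ (inv_hist I) lk) //; apply: imset_f.
by apply/(inv_types I); exists w.
Qed.

Lemma emit_enabled P hd l s p a c k st i : invariant P hd l s p ->
  onth (l c) k = Some i -> (i, st) \notin s ->
  exists p', next p a (Emit c k st) = Some p'.
Proof.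
move=> I lk es /=; case: ifP; first by eexists; reflexivity.
move/negP; case; apply/forall_inP => u /(inv_types I)[w vw ->].
apply/forallP => x; rewrite (at_slotP _ _ _ (inv_hist I) lk).
by apply/implyP => /eqP wx; rewrite /emitted ffunE /= wx.
Qed.

Lemma invariant_drop P hd l s p a c k p' : invariant P hd l s p ->
  k < size (l c) -> next p a (Drop Stage c k) = Some p' ->
  invariant P hd (update l c (take k (l c) ++ drop k.+1 (l c))) s p'.
Proof.
move=> I kl /=; case: ifP => // /forall_inP en [<-] {p'}.
have [ul sl inl] := inv_hist I c.
case lk: (onth (l c) k) => [i|]; last by move: kl; rewrite -onthTE lk.
have il : i \in l c by apply/onthP; exists k.
have [ic iP] := inl i il.
have done_i st : (i, st) \in s.
  have := forallP (en _ (invariant_single I iP)) ord0.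
  rewrite (at_slotP _ _ _ (inv_hist I) lk) /upd eqxx => /implyP/(_ (eqxx _))/forallP/(_ st).
  by rewrite /emitted ffunE /= ?eqxx.
have kE := index_onth ul lk.
have remI : take k (l c) ++ drop k.+1 (l c) = rem i (l c) by rewrite remE kE.
split=> //=; try by case: I.
- move=> d; rewrite ffunE; case: eqVneq => [->|_]; last exact: (inv_hist I).
  rewrite remI; split; first exact: rem_uniq.
    by rewrite size_rem // (leq_trans (leq_pred _)).
  by move=> j /mem_rem; apply: inl.
- move=> j st jP; rewrite ffunE; case: eqVneq => [jc|_]; last exact: (inv_done I).
  rewrite remI mem_rem_uniq // inE negb_and negbK => /orP[/eqP->//|].
  by rewrite -jc; apply: (inv_done I).
- move=> d; rewrite !ffunE; case: eqVneq => _; last exact: (inv_size I).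
  rewrite remI size_rem // (inv_size I) inordK //.
  by rewrite ltnS (leq_trans (leq_pred _)) // (leq_trans sl).
move=> u; split=> [/imsetP[v /(inv_types I)[w vw ->] ->]|[w vw ->]].
  by exists w => //; rewrite (type_dropP _ _ (inv_hist I) lk).
rewrite (type_dropP _ _ (inv_hist I) lk) //; apply: imset_f.
by apply/(inv_types I); exists w.
Qed.

Lemma drop_enabled P hd l s p a c k i : invariant P hd l s p ->
  onth (l c) k = Some i -> (forall st, (i, st) \in s) ->
  exists p', next p a (Drop Stage c k) = Some p'.
Proof.
move=> I lk es /=; case: ifP; first by eexists; reflexivity.
move/negP; case; apply/forall_inP => u /(inv_types I)[w vw ->].
apply/forallP => x; rewrite (at_slotP _ _ _ (inv_hist I) lk).
apply/implyP => /eqP wx; apply/forallP => st.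
by rewrite /emitted ffunE /= wx.
Qed.

Lemma invariant_right P hd l s p c o p' : invariant P hd l s p ->
  onth (P c) (hd c) = Some o ->
  next p (read P hd) (Right Stage h.+1 c) = Some p' ->
  invariant P (update hd c (hd c).+1)
    (update l c (rcons (l c) (c, hd c, o))) s p'.
Proof.
move=> I Pc /=; rewrite ffunE Pc; case: ifP => // sz [<-] {p'}.
set i := (c, hd c, o); set hd' := update _ _ _.
have iP : i \in instrs P by rewrite mem_instrs Pc.
(* The move adds [i] alone, since core and label determine an instruction of [P]. *)
have hdE j : left_of_head P hd' j = left_of_head P hd j || (j == i).
  rewrite /left_of_head ffunE; case: (eqVneq j i) => [->|ne].
    by rewrite iP eqxx ltnSn orbT.
  rewrite orbF; case: eqVneq => // jc; case jP: (j \in _); rewrite ?andbF // !andbT.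
  rewrite ltnS leq_eqVlt jc; case: eqVneq => // jl.
  case/eqP: ne; move: jP; rewrite mem_instrs jc jl Pc => /eqP[oj].
  by rewrite /i oj -jl -jc; case: (j) => [[]].
have inR : ~~ left_of_head P hd i by rewrite /left_of_head ltnn.
have [ul sl inl] := inv_hist I c.
have il : i \notin l c by apply: contra inR => /inl[].
have ns st : (i, st) \notin s.
  by apply: contra inR => /(inv_read I).
have lt j : left_of_head P hd j -> core j = c -> label j < label i.
  by move=> /andP[+ _] jc; rewrite jc.
split=> //=; try by case: I.
- move=> d; rewrite ffunE; case: eqVneq => [->|_].
    rewrite rcons_uniq il size_rcons -(inv_size I); split=> // j.
    rewrite mem_rcons inE hdE => /predU1P[->|/inl[-> ->]//].
    by rewrite eqxx orbT.
  have [ud sd ind] := inv_hist I d; split=> // j /ind[jd jP].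
  by rewrite hdE jP.
- by move=> e /(inv_read I); rewrite hdE => ->.
- move=> j st; rewrite hdE ffunE => /orP[jP|/eqP->].
    case: eqVneq => [jc|_]; last exact: (inv_done I).
    rewrite mem_rcons inE negb_or -jc => /andP[_]; exact: (inv_done I).
  by rewrite eqxx mem_rcons mem_head.
- move=> d; rewrite !ffunE; case: eqVneq => _; last exact: (inv_size I).
  by rewrite size_rcons inordK ?(inv_size I) // -(inv_size I).
have szc : inord (p.2 c) = inord (size (l c)) :> 'I_h.+1 by rewrite (inv_size I).
have asg := type_assignP h (erefl : core i = c) lt ns inR _ _ il.
move=> u; split.
  rewrite inE => /orP[/(inv_types I)[w vw ->]|].
    exists w; last first.
      rewrite type_rconsP // => x wx.
      by have := vw.1 _ _ wx; rewrite (negPf inR).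
    by split; [move=> x j /vw.1; rewrite hdE => -> | exact: vw.2].
  case/bigcupP => x _ /imsetP[v]; rewrite inE => /andP[/(inv_types I)[w vw ->] wx] ->.
  have {}wx : w x = None by move: wx; rewrite /info ffunE; case: (w x).
  exists (upd w x (Some i)); last by rewrite asg // szc.
  rewrite /upd; split=> [y j|y z j].
    by rewrite hdE; case: eqP => [_ [<-]|_ /vw.1->]; rewrite ?eqxx ?orbT.
  case: eqP => [->|_]; case: eqP => [->|_] //.
  - by move=> [<-] /vw.1; rewrite (negPf inR).
  - by move=> /[swap] -[<-] /vw.1; rewrite (negPf inR).
  - exact: vw.2.
case=> w [wR wI] ->; rewrite inE.
(* A valuation that uses [i] arises by [type_assign] from the old valuation with [i] erased; any
   other is itself an old valuation. *)
case: (pickP (fun x => w x == Some i)) => [x /eqP wx|nw].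
  apply/orP; right; apply/bigcupP; exists x => //.
  pose w' := upd w x None.
  have vw' : valid (left_of_head P hd) w'.
    rewrite /w' /upd; split=> [y j|y z j].
      case: eqP => // ne wy; have := wR y j wy; rewrite hdE => /orP[//|/eqP ji].
      by case: ne; apply: (wI _ _ i); rewrite // -ji.
    by case: eqP => // _; case: eqP => // _; apply: wI.
  have w'x : w' x = None by rewrite /w' /upd eqxx.
  have -> : type_of h (update l c (rcons (l c) i)) s w =
      type_assign c o (inord (p.2 c)) x (type_of h l s w').
    rewrite szc -asg //; apply: type_of_ext => y; rewrite /w' /upd.
    by case: eqP => [->|//].
  apply: imset_f; rewrite inE; apply/andP; split.
    by apply/(inv_types I); exists w'.
  by rewrite /info ffunE w'x.
apply/orP; left; apply/(inv_types I); exists w.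
  split=> // x j wx; have := wR x j wx; rewrite hdE => /orP[//|/eqP ji].
  by have := nw x; rewrite wx ji eqxx.
by rewrite type_rconsP // => x wx; have := nw x; rewrite wx eqxx.
Qed.

Lemma right_enabled P hd l s p c o : invariant P hd l s p ->
  onth (P c) (hd c) = Some o -> size (l c) < h.+1 ->
  exists p', next p (read P hd) (Right Stage h.+1 c) = Some p'.
Proof.
by move=> I Pc sl; rewrite /= ffunE Pc (inv_size I) sl; eexists.
Qed.

Lemma invariant_init P : invariant P [ffun=> 0] [ffun=> [::]] [::]
  ([set type_of h [ffun=> [::]] [::] (fun=> None)], [ffun=> ord0]).
Proof.
have nR i : left_of_head P [ffun=> 0] i = false by rewrite /left_of_head ffunE.
split=> //=.
- by move=> c; rewrite ffunE; split.
- by move=> i st; rewrite nR.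
- by move=> c; rewrite !ffunE.
move=> u; rewrite inE; split=> [/eqP->|[w [wR _] ->]]; first by exists (fun=> None).
apply/eqP/type_of_ext => x; case wx: (w x) => [i|//].
by have := wR x i wx; rewrite nR.
Qed.

(** * Soundness *)

Hypothesis qdepth_le : forall ax, List.In ax A -> qdepth ax <= K.+1.
Hypothesis univA : universal A.

Lemma accepting_ok P hd l s p : invariant P hd l s p -> accepting p (read P hd) ->
  [/\ uniq s, s =i Events Stage P & models P (emitted_before s) A].
Proof.
move=> I /andP[/forallP ends /forall_inP acc].
have rd i : left_of_head P hd i = (i \in instrs P).
  rewrite /left_of_head; case iP: (i \in _); rewrite ?andbF // andbT.
  have := ends (core i); rewrite ffunE => /eqP e.
  have il : label i < size (P (core i)).
    by move: iP; rewrite mem_instrs -onthTE => /eqP->.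
  by apply: leq_trans il _; rewrite -onthNE e.
(* An undropped [i] would have a slot in the type of the valuation assigning only [i], which
   acceptance excludes. *)
have l0 c i : i \notin l c.
  apply/negP => il; have [_ _ inl] := inv_hist I c; have [ic iP] := inl i il.
  have /andP[_ /forallP/(_ ord0)] := acc _ (invariant_single I iP).
  by rewrite /info ffunE /upd eqxx /= ic /slot il.
split; first exact: inv_uniq I.
  move=> e; rewrite mem_Events -rd; apply/idP/idP => [/(inv_read I)//|].
  by case: e => i st iP; apply: (inv_done I) => //; apply: l0.
apply/(models_good h qdepth_le P l s univA) => w [wP wI].
have /acc/andP[] // : type_of h l s w \in p.1.
by apply/(inv_types I); exists w => //; split=> // x i /wP; rewrite /= rd.
Qed.

Lemma run_ok P (C C' : config machine) s' : run P C s' C' ->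
  forall s p, cstate C = Some p -> invariant P (hpos C) (hist C) s p ->
  cstate C' = None ->
  [/\ uniq (s ++ s'), s ++ s' =i Events Stage P
    & models P (emitted_before (s ++ s')) A].
Proof.
elim=> {C s' C'} [C s p -> //|C e C' s' C'' st _ rn IH s p Cp I C''0].
(* No transition leaves [None], so nothing is emitted after acceptance. *)
have absorb : cstate C' = None -> s' = [::].
  case: rn => // C1 e1 C2 s2 C3 st1 _ _ C1N; move: C1N.
  by case: st1 => /= [q hd l c o q' d _|q hd l q' d|q hd l c k st0 i q' d _|q hd l c k q' d _]
    qN; move: d; rewrite qN.
case: st Cp I IH absorb => /=.
- move=> q hd l c o [p'|] + Pc qp; rewrite {}qp //= => /eqP E I IH _.
  by apply: IH C''0 => //; apply: invariant_right E.
- move=> q hd l [p'|] + qp; rewrite {}qp //= => acc I IH /(_ erefl) ->.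
  by rewrite cats0; apply: accepting_ok I acc.
- move=> q hd l c k st i [p'|] + lk qp; rewrite {}qp //= => /eqP E I IH _.
  rewrite -cat_rcons; apply: IH C''0; first reflexivity.
  exact: (invariant_emit (a := read P hd)) I lk E.
- move=> q hd l c k [p'|] + kl qp; rewrite {}qp //= => /eqP E I IH _.
  apply: IH C''0; first reflexivity.
  exact: (invariant_drop (a := read P hd)) I kl E.
Qed.

Lemma machine_sound : sound machine A.
Proof.
move=> P s [C [rn Cf]].
have [us sP mA] :=
  run_ok rn (erefl : cstate (init_config machine) = Some _) (invariant_init P) Cf.
(* The required graph is the trace itself. *)
exists (emitted_before s); split=> //; first by case: (emitted_before_linear sP).
by split=> // e1 e2 /hb_emitted_before/and3P[].
Qed.

(** * Completeness for reordering bounded traces *)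

Definition complete_in (s : seq event) (i : instr) : bool :=
  [forall st, (i, st) \in s].

Definition ready P (C : config machine) s : Prop :=
  exists p, [/\ cstate C = Some p, invariant P (hpos C) (hist C) s p
    & forall i, i \in hist C (core i) -> ~~ complete_in s i].

Lemma run_cat P (C C' C'' : config machine) s s' :
  run P C s C' -> run P C' s' C'' -> run P C (s ++ s') C''.
Proof.
move=> r r'; elim: r r' => {C C' s} // C e C' s C1 st al _ IH /IH r'.
by have := RunCons st al r'; case: e {st}.
Qed.

Lemma invariant_allowed P (C : config machine) s p :
  invariant P (hpos C) (hist C) s p -> allowed C.
Proof. by move=> I c; have [] := inv_hist I c. Qed.

(** Reading or emitting completes at most the one instruction concerned, so a single drop restores
    [ready]. *)
Lemma clean P (C : config machine) s p i :
  cstate C = Some p -> invariant P (hpos C) (hist C) s p ->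
  (forall j, j \in hist C (core j) -> j != i -> ~~ complete_in s j) ->
  exists C', [/\ run P C [::] C', hpos C' = hpos C & ready P C' s].
Proof.
case: C => q hd l /= -> I inc.
case: (boolP ((i \in l (core i)) && complete_in s i)) => [/andP[il ci]|nc].
  have [k lk] := onthP il; have [ul sl inl] := inv_hist I (core i).
  have kl : k < size (l (core i)) by rewrite -onthTE lk.
  have kE := index_onth ul lk.
  have kh : k < h.+1 := leq_trans kl sl.
  have [p' E] := drop_enabled (k := Ordinal kh) (read P hd) I lk (forallP ci).
  have I' := invariant_drop (k := Ordinal kh) I kl E.
  pose C1 : config machine := Config (Some p' : state machine) hd
    (update l (core i) (take k (l (core i)) ++ drop k.+1 (l (core i)))).
  exists C1; split=> //.
    apply: (RunCons (e := None)) (RunNil _ _); last exact: (invariant_allowed (C := C1) I').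
    by apply: (StepDrop (k := Ordinal kh : 'I_(history machine))) kl; apply/eqP; exact: E.
  exists p'; split=> //= j; rewrite ffunE; case: eqVneq => [jc|ne jl].
    rewrite -[in take _ _]kE -[in drop _ _]kE -remE mem_rem_uniq // inE => /andP[ne jl].
    by apply: inc; rewrite ?jc.
  by apply: inc => //; apply: contra ne => /eqP->.
exists (Config (Some p : state machine) hd l); split=> //; first exact: RunNil.
exists p; split=> // j jl; case: (eqVneq j i) => [ji|]; last exact: inc.
by move: nc jl; rewrite ji negb_and => /orP[/negP|//].
Qed.

Lemma advance P (C : config machine) s c o : ready P C s ->
  onth (P c) (hpos C c) = Some o -> size (hist C c) < h.+1 ->
  exists C', [/\ run P C [::] C', hpos C' = update (hpos C) c (hpos C c).+1
    & ready P C' s].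
Proof.
case: C => q hd l [p [/= -> I inc]] Pc sl.
have [p' E] := right_enabled I Pc sl; have I' := invariant_right I Pc E.
pose C1 : config machine := Config (Some p' : state machine)
  (update hd c (hd c).+1) (update l c (rcons (l c) (c, hd c, o))).
have st : step P (Config (Some p : state machine) hd l) None C1.
  by apply: StepRight Pc; apply/eqP; exact: E.
(* When [Stage] is empty, an instruction is complete as soon as it is read. *)
have [|C' [rn hdE rdy]] := clean (C := C1) (i := (c, hd c, o)) (erefl _) I'.
  move=> j /=; rewrite ffunE; case: eqVneq => [jc|_ jl _]; last exact: inc.
  by rewrite mem_rcons inE => /predU1P[->|jl _]; rewrite ?eqxx //; apply: inc; rewrite jc.
exists C'; split=> //; apply: (RunCons (e := None) st) rn.
exact: (invariant_allowed (C := C1) I').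
Qed.

Lemma emit P (C : config machine) s i st : ready P C s ->
  left_of_head P (hpos C) i -> (i, st) \notin s ->
  exists C', [/\ run P C [:: (i, st)] C', hpos C' = hpos C
    & ready P C' (rcons s (i, st))].
Proof.
case: C => q hd l [p [/= -> I inc]] iP es.
have il : i \in l (core i) by apply: contraR es => il; apply: (inv_done I).
have [k lk] := onthP il; have [_ sl _] := inv_hist I (core i).
have kh : k < h.+1 by apply: leq_trans sl; rewrite -onthTE lk.
have [p' E] := emit_enabled (k := Ordinal kh) (read P hd) I lk es.
have I' := invariant_emit (k := Ordinal kh) I lk E.
set C1 : config machine := Config (Some p' : state machine) hd l.
have st1 : step P (Config (Some p : state machine) hd l) (Some (i, st)) C1.
  by apply: (StepEmit (k := Ordinal kh : 'I_(history machine))) lk; apply/eqP; exact: E.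
have [|C' [rn hdE rdy]] := clean (C := C1) (i := i) (erefl _) I'.
  move=> j jl ne; apply: contra (inc j jl) => /forallP cj; apply/forallP => st'.
  have := cj st'; rewrite mem_rcons inE => /predU1P[[ji _]|//].
  by rewrite ji eqxx in ne.
exists C'; split=> //; apply: (RunCons st1) rn.
exact: (invariant_allowed (C := C1) I').
Qed.

Lemma reach P (C : config machine) s1 i st s2 :
  let s := s1 ++ (i, st) :: s2 in
  uniq s -> s =i Events Stage P -> reordering_bounded h.+1 P s ->
  ready P C s1 ->
  exists C', [/\ run P C [::] C', ready P C' s1 & left_of_head P (hpos C') i].
Proof.
move=> s us sP bd.
have iP : i \in instrs P.
  by have := sP (i, st); rewrite mem_Events mem_cat mem_head orbT => <-.
have ins : (i, st) \notin s1.
  by move: us; rewrite cat_uniq => /and3P[_ /hasPn/(_ (i, st)) + _]; apply; rewrite mem_head.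
move: {2}(_ - _) (leqnn ((label i).+1 - hpos C (core i))) => m.
elim: m C => [|m IH] C.
  rewrite leqn0 subn_eq0 => lt rdy; exists C; split=> //; first exact: RunNil.
  by rewrite /left_of_head lt.
move=> mE rdy; case: (leqP (label i).+1 (hpos C (core i))) => [lt|].
  by exists C; split=> //; [exact: RunNil | rewrite /left_of_head lt].
rewrite ltnS => le; have [p [Cp I inc]] := rdy.
have [ul _ inl] := inv_hist I (core i).
(* Room for one more instruction: undropped instructions have distinct labels in the window of [h]
   labels just below [label i]. If [label i < h], truncated subtraction starts the window at 0,
   which still covers them. *)
have sl : size (hist C (core i)) < h.+1.
  have lab_inj : {in hist C (core i) &, injective (@label n Op)}.
    move=> j j' /inl[jc /andP[_ +]] /inl[jc' /andP[_ +]] jj'.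
    rewrite !mem_instrs jc jc' jj' => /eqP-> /eqP[].
    case: j j' jc jc' jj' => [[c a] b] [[c' a'] b'].
    by rewrite /core /label /opn /= => -> -> -> ->.
  rewrite -(size_map (@label n Op)) ltnS -(size_iota (label i - h) h).
  apply: uniq_leq_size; first by rewrite map_inj_in_uniq.
  move=> _ /mapP[j jl ->]; have [jc /andP[jlt jP]] := inl j jl.
  have {}jlt : label j < label i by rewrite jc in jlt; apply: leq_trans jlt le.
  have /forallPn[st' njs] : ~~ complete_in s1 j by apply: inc; rewrite jc.
  have ne : ((i, st) == (j, st')) = false.
    by apply/negP => /eqP[ij _]; rewrite ij ltnn in jlt.
  (* Some event of [j] is missing from [s1], hence comes after [(i, st)] in [s], and clause (1)
     applies. *)
  have dj : (diff j i < h.+1%:Z)%R.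
    apply: (proj1 (bd j i jP iP jc)); exists st', st.
    rewrite /s !index_cat (negPf njs) (negPf ins) /= eqxx ne.
    by rewrite addn0 addnS ltnS leq_addr.
  move: dj; rewrite /diff ltrBlDr -PoszD ltz_nat => dj.
  rewrite mem_iota; apply/andP; split; first by rewrite leq_subLR -ltnS -addSn.
  by apply: leq_trans jlt _; rewrite addnC -leq_subLR.
have [o Po] : exists o, onth (P (core i)) (hpos C (core i)) = Some o.
  have : hpos C (core i) < size (P (core i)).
    by apply: leq_ltn_trans le _; move: iP; rewrite mem_instrs -onthTE => /eqP->.
  by rewrite -onthTE; case: (onth _ _) => // o _; exists o.
have [C1 [rn hdE rdy1]] := advance rdy Po sl.
have [|C' [rn' rdy' lh]] := IH C1 _ rdy1.
  by rewrite hdE ffunE eqxx subSS -ltnS -subSn.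
by exists C'; split=> //; apply: (run_cat rn rn').
Qed.

Lemma run_emit P s : uniq s -> s =i Events Stage P ->
  reordering_bounded h.+1 P s ->
  forall s2 s1 (C : config machine), s = s1 ++ s2 -> ready P C s1 ->
  exists2 C', run P C s2 C' & ready P C' s.
Proof.
move=> us sP bd; elim=> [|[i st] s2 IH] s1 C sE rdy.
  by exists C; [exact: RunNil | rewrite sE cats0].
rewrite sE in us sP bd; have [C1 [r1 rdy1 iP]] := reach us sP bd rdy.
have es : (i, st) \notin s1.
  by move: us; rewrite cat_uniq => /and3P[_ /hasPn/(_ (i, st)) + _]; apply; rewrite mem_head.
have [C2 [r2 _ rdy2]] := emit rdy1 iP es.
have [|C3 r3 rdy3] := IH (rcons s1 (i, st)) C2 _ rdy2; first by rewrite cat_rcons.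
by exists C3 => //; apply: (run_cat r1 (run_cat r2 r3)).
Qed.

Lemma hist_nil P s (C : config machine) c : s =i Events Stage P -> ready P C s ->
  hist C c = [::].
Proof.
move=> sP [p [_ I inc]]; case E: (hist C c) => [//|i r].
have il : i \in hist C c by rewrite E mem_head.
have [_ _ inl] := inv_hist I c; have [ic /andP[_ iP]] := inl i il.
have /negP[] : ~~ complete_in s i by apply: inc; rewrite ic.
by apply/forallP => st; rewrite sP mem_Events.
Qed.

(** When [Stage] is empty, emission never moves the heads, so they are brought to the ends
    separately. Histories are empty by [hist_nil], which leaves room for every move. *)
Lemma run_end P s (C : config machine) : s =i Events Stage P -> ready P C s ->
  exists C', [/\ run P C [::] C', ready P C' s
    & forall c, onth (P c) (hpos C' c) = None].
Proof.
move=> sP.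
move: {2}(\sum_c _) (leqnn (\sum_c (size (P c) - hpos C c))) => m.
elim: m C => [|m IH] C mE rdy.
  exists C; split=> //; first exact: RunNil.
  move=> c; apply: onth_default; rewrite -subn_eq0 -leqn0; apply: leq_trans mE.
  by rewrite (bigD1 c) //= leq_addr.
case: (pickP (fun c => onth (P c) (hpos C c) : bool)) => [c Pc|none].
  case Po: (onth (P c) (hpos C c)) Pc => [o|//] _.
  have lt : hpos C c < size (P c) by rewrite -onthTE Po.
  have [|C1 [r1 hdE rdy1]] := advance rdy Po; first by rewrite (hist_nil c sP rdy).
  have [|C' [r' rdy' e']] := IH C1 _ rdy1.
    rewrite -ltnS (leq_trans _ mE) // (bigD1 c) //= [ltnRHS](bigD1 c) //= hdE.
    rewrite ffunE eqxx -addSn subnSK // leq_add2l; apply: leq_sum => d /negPf dc.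
    by rewrite ffunE dc.
  by exists C'; split=> //; apply: (run_cat r1 r').
exists C; split=> //; first exact: RunNil.
by move=> c; have := none c; case: (onth _ _).
Qed.

Lemma machine_complete : refinable n A -> complete h.+1 machine A.
Proof.
move=> refA P G gG mG s [us sP sG] bd.
(* Refinability transfers the axioms from [G] to its linearization. *)
have {}mG : models P (emitted_before s) A.
  apply: (refA P G) => //; first exact: emitted_before_linear.
  move=> e1 e2 ee; apply/hb_emitted_before; rewrite /emitted_before sG //= andbT.
  have [gE _] := gG; rewrite !sP; elim: ee => {e1 e2} [e1 e2 /gE[-> ->]//|].
  by move=> e1 e2 e3 _ /andP[-> _] _ /andP[_ ->].
have [|C r rdy] := run_emit us sP bd (s1 := [::]) (C := init_config machine) (erefl s).
  eexists; split; [reflexivity | exact: invariant_init |].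
  by move=> i /=; rewrite ffunE.
have [C' [r' rdy' e']] := run_end sP rdy.
exists (Config (None : state machine) (hpos C') (hist C')); split=> //.
rewrite -[s]cats0; apply: (run_cat r); rewrite -[[::]]cats0; apply: (run_cat r').
have hn c := hist_nil c sP rdy'.
have [p [C'p I _]] := rdy'.
apply: (RunCons (e := None)) (RunNil _ _).
  case: C' C'p I e' hn {r' rdy'} => q hd l /= -> I e' hn.
  apply: StepStay; apply/andP; split=> //.
  apply/andP; split; first by apply/forallP => c; rewrite ffunE e'.
  apply/forall_inP => u /(inv_types I)[w [wR wI] ->]; apply/andP; split.
    apply: (iffLR (models_good h qdepth_le P l s univA) mG); split=> // x i.
    by move=> /wR/andP[].
  apply/forallP => x; rewrite /info ffunE; case: (w x) => //= i.
  by rewrite /slot hn.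
exact: (invariant_allowed (C := Config _ _ _) I).
Qed.

End Machine.

Theorem theorem2 (n : nat) (Op Stage : finType) (S : signature Op)
    (A : semantics Stage S) (t : nat) :
  universal A -> refinable n A -> extensible n A -> 1 <= t ->
  {M : opmodel n Op Stage | sound M A /\ complete t M A}.
Proof.
(* With [t = h.+1], the history parameter of [machine] is exactly [t]. *)
case: t => // h uA refA _ _.
(* The largest number of quantified variables in an axiom. *)
pose K := foldr (fun ax m => maxn (qdepth ax) m) 0 A.
have qK ax : List.In ax A -> qdepth ax <= K.+1.
  rewrite /K => aA; apply: leqW; elim: A aA {uA refA K} => //= ax' B IH [<-|/IH].
    exact: leq_maxl.
  by move/leq_trans; apply; apply: leq_maxr.
exists (machine n h K A); split; first exact: machine_sound.
exact: machine_complete.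
Qed.
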